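(* Let $G=(V,E)$ be a perfect $n$-ary tree with depth $d$. Then the tree algorithm is a linear-time algorithm that solves the $S$-labeling problem on $G$ to optimality, i.e. every labeling it produces attains $SL_{\phi^*}(G)=\min_\phi SL_\phi(G)$. Moreover, $$SL_{\phi^*}(G)=\frac{(|V|-1)^2}{2(n+1)}+\frac{|V|-1}{2}\quad\text{if } d \text{ is odd,}$$ $$SL_{\phi^*}(G)=\frac{(|V|-1-n)^2}{2(n+1)}+\frac{n(|V|-1-n)}{n+1}+\frac{|V|-1+n}{2}\quad\text{if } d \text{ is even.}$$
   Context: For a graph $G=(V,E)$ and a labeling (bijection) $\phi:V\to\{1,\ldots,|V|\}$, the $S$-labeling number with respect to $\phi$ is $SL_\phi(G)=\sum_{\{u,v\}\in E}\min\{\phi(u),\phi(v)\}$. The $S$-labeling problem asks for a labeling $\phi^*$ minimizing this value. A perfect $n$-ary tree ($n\ge1$) is a rooted tree in which all internal (non-leaf) nodes have $n$ children and all leaf nodes are at the same depth $d$. Depths are counted so that the root has depth $1$ (its children have depth $2$, and so on). Tree algorithm: if $d$ is odd, label the nodes at even depths (in any order) with the smallest unused labels and then label the remaining nodes arbitrarily with the remaining labels. If $d$ is even, label the nodes at odd depths other than the root (in any order) with the smallest unused labels, then label the root with the smallest unused label, and then label the remaining nodes arbitrarily with the remaining labels. *)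

(* Defs.v *)
From mathcomp Require Import all_boot all_order all_algebra.

Set Implicit Arguments.
Unset Strict Implicit.
Unset Printing Implicit Defensive.

(* A finite simple graph is a symmetric irreflexive relation on a finType.    *)

(* With e symmetric, [:: x; y] is a cycle for every edge, so genuine cycles   *)
(* are those of size at least 3.                                              *)
Definition is_tree (V : finType) (e : rel V) : Prop :=
  [/\ symmetric e, irreflexive e, forall x y : V, connect e x y
    & forall c : seq V, ucycle e c -> size c <= 2].

(* Least number of edges of a walk from x to y (#|V| if there is none).       *)
Definition dist (V : finType) (e : rel V) (x y : V) : nat :=
  find (fun k => [exists p : k.-tuple V, path e x p && (last x p == y)])
       (iota 0 #|V|).

Definition depth (V : finType) (e : rel V) (r v : V) : nat := (dist e r v).+1.

Definition children (V : finType) (e : rel V) (r v : V) : {set V} :=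
  [set u | e v u & depth e r u == (depth e r v).+1].

Definition leaf (V : finType) (e : rel V) (r v : V) : bool :=
  children e r v == set0.

Definition perfect_nary_tree (n d : nat) (V : finType) (e : rel V) (r : V)
    : Prop :=
  [/\ is_tree e,
      forall v, ~~ leaf e r v -> #|children e r v| = n
    & forall v, leaf e r v -> depth e r v = d].

Definition is_labeling (V : finType) (phi : V -> nat) : Prop :=
  [/\ forall v, 1 <= phi v <= #|V|, injective phi
    & forall k, 1 <= k <= #|V| -> exists v, phi v = k].

(* enum_rank selects one of the two orientations of each edge.                *)
Definition SL (V : finType) (e : rel V) (phi : V -> nat) : nat :=
  \sum_(p : V * V | e p.1 p.2 && (enum_rank p.1 < enum_rank p.2))
     minn (phi p.1) (phi p.2).

Definition optimal_labeling (V : finType) (e : rel V) (phi : V -> nat) : Prop :=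
  is_labeling phi /\ forall psi, is_labeling psi -> SL e phi <= SL e psi.

(* Giving each node of the sequence s in turn the smallest unused label.      *)
Definition label_along (V : finType) (s : seq V) (v : V) : nat := (index v s).+1.

(* The labelings the tree algorithm may produce: the sequences s1 and s2 are  *)
(* its free choices of order.                                                 *)
Definition tree_algorithm (d : nat) (V : finType) (e : rel V) (r : V)
    (phi : V -> nat) : Prop :=
  exists s1 s2 : seq V,
    if odd d then
      [/\ perm_eq s1 [seq v <- enum V | ~~ odd (depth e r v)],
          perm_eq s2 [seq v <- enum V | odd (depth e r v)]
        & phi =1 label_along (s1 ++ s2)]
    else
      [/\ perm_eq s1 [seq v <- enum V | odd (depth e r v) && (v != r)],
          perm_eq s2 [seq v <- enum V | ~~ odd (depth e r v)]
        & phi =1 label_along (s1 ++ r :: s2)].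

(* Machine model for running times: structured programs over numbered         *)
(* registers and numbered random-access arrays of naturals.  Each node of an  *)
(* expression and each executed instruction or test costs one unit.  The only *)
(* arithmetic operations are successor and predecessor, so stored values grow *)
(* by at most one per unit of time and a linear-time run only handles         *)
(* integers of O(log N) bits.                                                 *)

Inductive expr : Type :=
  | Const of nat
  | Reg of nat
  | Get of nat & expr
  | Succ of expr
  | Pred of expr.

Inductive cmd : Type :=
  | Skip
  | Assign of nat & expr
  | Put of nat & expr & expr
  | Seq of cmd & cmd
  | IfLt of expr & expr & cmd & cmd
  | WhileLt of expr & expr & cmd.

Record state : Type := State { reg : nat -> nat; arr : nat -> nat -> nat }.

Definition set_reg (st : state) (x v : nat) : state :=
  State (fun y => if y == x then v else reg st y) (arr st).

Definition set_arr (st : state) (a i v : nat) : state :=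
  State (reg st)
    (fun b j => if (b == a) && (j == i) then v else arr st b j).

Fixpoint eval (st : state) (x : expr) : nat :=
  match x with
  | Const k => k
  | Reg y => reg st y
  | Get a i => arr st a (eval st i)
  | Succ y => (eval st y).+1
  | Pred y => (eval st y).-1
  end.

Fixpoint ecost (x : expr) : nat :=
  match x with
  | Const _ | Reg _ => 1
  | Get _ y | Succ y | Pred y => (ecost y).+1
  end.

(* exec c st t st' : from state st, c terminates in state st' at cost t.      *)
Inductive exec : cmd -> state -> nat -> state -> Prop :=
  | ExecSkip st : exec Skip st 1 st
  | ExecAssign st y x :
      exec (Assign y x) st (ecost x).+1 (set_reg st y (eval st x))
  | ExecPut st a i x :
      exec (Put a i x) st (ecost i + ecost x).+1
           (set_arr st a (eval st i) (eval st x))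
  | ExecSeq c1 c2 st1 st2 st3 t1 t2 :
      exec c1 st1 t1 st2 -> exec c2 st2 t2 st3 ->
      exec (Seq c1 c2) st1 (t1 + t2) st3
  | ExecIfTrue x y c1 c2 st t st' :
      eval st x < eval st y -> exec c1 st t st' ->
      exec (IfLt x y c1 c2) st (ecost x + ecost y + t).+1 st'
  | ExecIfFalse x y c1 c2 st t st' :
      eval st y <= eval st x -> exec c2 st t st' ->
      exec (IfLt x y c1 c2) st (ecost x + ecost y + t).+1 st'
  | ExecWhileFalse x y c st :
      eval st y <= eval st x ->
      exec (WhileLt x y c) st (ecost x + ecost y).+1 st
  | ExecWhileTrue x y c st1 st2 st3 t1 t2 :
      eval st1 x < eval st1 y ->
      exec c st1 t1 st2 -> exec (WhileLt x y c) st2 t2 st3 ->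
      exec (WhileLt x y c) st1 (ecost x + ecost y + t1 + t2).+1 st3.

(* Input: the nodes are numbered 0, .., #|V| - 1 by nu; register 0 holds #|V| *)
(* and register 1 the number of the root.  The neighbours of node i are       *)
(* listed, in any order, in array 1 from position (array 0)[i] up to          *)
(* (array 0)[i+1] excluded, starting at (array 0)[0] = 0.  All other memory   *)
(* has arbitrary contents.                                                    *)
Definition represents (V : finType) (e : rel V) (r : V) (nu : V -> nat)
    (st : state) : Prop :=
  [/\ injective nu, forall v, nu v < #|V|,
      reg st 0 = #|V| /\ reg st 1 = nu r, arr st 0 0 = 0
    & forall v, perm_eq
        [seq arr st 1 j | j <- index_iota (arr st 0 (nu v)) (arr st 0 (nu v).+1)]
        [seq nu u | u <- enum V & e v u]].

(* Output: the label of node i is left in cell i of array 2.                  *)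
Definition output_labeling (V : finType) (nu : V -> nat) (st : state) : V -> nat :=
  fun v => arr st 2 (nu v).

(* The program p is an implementation of the tree algorithm that runs in      *)
(* time O(|V|), uniformly in the tree, its arity and its depth; exec is       *)
(* deterministic, so the run exhibited is the only one.                       *)
Definition linear_time_tree_algorithm (p : cmd) : Prop :=
  exists C : nat,
    forall (n d : nat) (V : finType) (e : rel V) (r : V),
      1 <= n -> perfect_nary_tree n d e r ->
    forall (nu : V -> nat) (st : state), represents e r nu st ->
    exists (t : nat) (st' : state),
      [/\ exec p st t st', t <= C * #|V|
        & tree_algorithm d e r (output_labeling nu st')].

(* Main.v *)
Require Import Defs.
From mathcomp Require Import all_boot all_order all_algebra.
From mathcomp Require Import zify ring.

(* Orient every edge towards its endpoint with the larger label, and let m u  *)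
(* be the out-degree of u: then SL phi = sum_u phi u * m u, where the m u sum *)
(* to |V| - 1 and are at most D = n + 1.  For a threshold K, the inequalities *)
(*   K * m u <= phi u * m u + D * (K - phi u)   (truncated subtraction)       *)
(* add up to a lower bound on SL phi in which the sum of the K - phi u does   *)
(* not depend on the labeling.  It is attained exactly when m u = D for       *)
(* phi u < K and m u = 0 for phi u > K, which the tree algorithm achieves: the *)
(* nodes of the depth parity opposite to d cover every edge exactly once and, *)
(* the root excepted, have degree n + 1.                                      *)
(* The linear-time program is a breadth-first search that records the parity  *)
(* of depths, followed by two passes over the queue.                          *)

Set Implicit Arguments.
Unset Strict Implicit.
Unset Printing Implicit Defensive.

(** The lower bound just described is [SL_threshold], an instance of linear-programming duality. Its
    inputs are [sum_labeling] and [card_orient]. Let k be the number of non-root nodes whose depth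
    has parity opposite to d. By [degree_internal] these nodes have degree n+1, and they meet every
    edge once, except for the n edges at the root when d is even. Hence |V|-1 is (n+1)k for odd d
    and (n+1)k+n for even d. With K = k+1 the algorithm meets the bound ([tree_algorithm_optimal]),
    and eliminating k from the common value (k+1)(|V|-1) - (n+1)C(k+1,2) gives the two closed forms
    ([SL_formula]). The tree structure enters mainly through uniqueness of parents,
    [uniq_neighbour_le]. For the running time, [wp_search] charges each scanned adjacency entry to a
    child or to the scanning node. The last node of the queue is a leaf, which reveals the parity of
    d; two runs of [wp_label_parity] then hand out the labels. *)

(** * Distances in a connected graph *)

Section Distance.

Variables (V : finType) (e : rel V).
Hypothesis e_conn : forall x y : V, connect e x y.

Lemma dist_le_path x p : path e x p -> dist e x (last x p) <= size p.
Proof.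
move=> ep; rewrite leqNgt; apply/negP => lt_p.
have ltV : size p < #|V|.
  by apply: leq_trans lt_p _; rewrite /dist -{2}(size_iota 0 #|V|) find_size.
have := before_find 0 lt_p; rewrite nth_iota // add0n => /existsP [].
by exists (in_tuple p); rewrite ep eqxx.
Qed.

Lemma dist_path x y :
  exists p, [/\ path e x p, last x p = y & size p = dist e x y].
Proof.
set a := fun k => [exists p : k.-tuple V, path e x p && (last x p == y)].
have ha : has a (iota 0 #|V|).
  have /connectP [p ep ey] := e_conn x y.
  (* Only lengths below [#|V|] are searched by [dist], so the walk is first made duplicate-free. *)
  case/shortenP: ep ey => p' ep' Up' _ ey; apply/hasP; exists (size p').
    by rewrite mem_iota add0n -[(_ < _)]/(size (x :: p') <= _) -(card_uniqP Up') max_card.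
  by apply/existsP; exists (in_tuple p'); rewrite ep' ey eqxx.
have := nth_find 0 ha; rewrite -/(dist e x y) nth_iota; last first.
  by move: ha; rewrite has_find size_iota.
rewrite /a; case/existsP=> p /andP[ep /eqP lp].
by exists p; split=> //; apply: size_tuple.
Qed.

Lemma dist_self x : dist e x x = 0.
Proof. by apply/eqP; rewrite -leqn0; apply: (@dist_le_path x [::]). Qed.

Lemma dist_eq0 x y : (dist e x y == 0) = (x == y).
Proof.
apply/eqP/eqP => [d0|<-]; last exact: dist_self.
by have [p [_ lp]] := dist_path x y; rewrite d0 -lp; case: p {lp}.
Qed.

Lemma dist_edge x u v : e u v -> dist e x v <= (dist e x u).+1.
Proof.
have [p [ep lp <-]] := dist_path x u => euv.
rewrite -(size_rcons p v) -{1}(last_rcons x p v) dist_le_path //.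
by rewrite rcons_path ep lp.
Qed.

Lemma dist_pred x v : v != x -> exists2 u, e u v & (dist e x u).+1 = dist e x v.
Proof.
have [p] := dist_path x v; case/lastP: p => [|p w] [ep lp sp] nv.
  by rewrite -lp eqxx in nv.
move: ep lp sp; rewrite rcons_path last_rcons size_rcons => /andP[ep ew] wv sp.
subst w; exists (last x p) => //; apply/eqP; rewrite eqn_leq dist_edge // andbT.
by rewrite -sp ltnS dist_le_path.
Qed.

End Distance.

(** * Sums over edges and edge orientations *)

Section Orientation.

Variables (V : finType) (e : rel V).
Hypothesis e_sym : symmetric e.

(** Pairs selected by both orientations occur in both sums; swapping coordinates exchanges the pairs
    on which the orientations disagree. *)
Lemma sum_orientation (w : V -> V -> nat) (o1 o2 : rel V) :
    (forall x y, w x y = w y x) ->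
    (forall x y, e x y -> o1 y x = ~~ o1 x y) ->
    (forall x y, e x y -> o2 y x = ~~ o2 x y) ->
  \sum_(p | e p.1 p.2 && o1 p.1 p.2) w p.1 p.2
    = \sum_(p | e p.1 p.2 && o2 p.1 p.2) w p.1 p.2.
Proof.
move=> wC h1 h2.
rewrite (bigID (fun p => o2 p.1 p.2)) [RHS](bigID (fun p => o1 p.1 p.2)) /=.
congr (_ + _); first by apply: eq_bigl => p; rewrite andbAC.
rewrite (reindex_inj (h := fun p : V * V => (p.2, p.1))) /=; last first.
  by move=> [a b] [c d] [-> ->].
apply: eq_big => [[x y]|[x y] _] /=; last exact: wC.
rewrite e_sym; case exy: (e x y) => //=.
by rewrite h1 // h2 // negbK andbC.
Qed.

Lemma SL_sum (phi : V -> nat) : injective phi -> irreflexive e ->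
  SL e phi = \sum_u phi u * #|[set v | e u v & phi u < phi v]|.
Proof.
move=> phi_inj e_irr; rewrite /SL.
have neq x y : e x y -> x != y.
  by move=> exy; apply: contraTneq exy => ->; rewrite e_irr.
rewrite (@sum_orientation (fun x y => minn (phi x) (phi y))
          (fun x y => enum_rank x < enum_rank y) (fun x y => phi x < phi y)).
- transitivity (\sum_(p | e p.1 p.2 && (phi p.1 < phi p.2)) phi p.1).
    by apply: eq_bigr => p /andP[_ lt]; apply/minn_idPl/ltnW.
  rewrite -(pair_big_dep xpredT (fun u v => e u v && (phi u < phi v)) (fun u _ => phi u)) /=.
  by apply: eq_bigr => u _; rewrite -sum1dep_card big_distrr /= muln1.
- by move=> x y; rewrite minnC.
- move=> x y /neq nxy; rewrite -leqNgt ltn_neqAle.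
  by rewrite (inj_eq val_inj) (inj_eq enum_rank_inj) eq_sym nxy.
- move=> x y /neq nxy; rewrite -leqNgt ltn_neqAle.
  by rewrite (inj_eq phi_inj) eq_sym nxy.
Qed.

End Orientation.

(** * Unique parents and edge counts in a rooted tree *)

Section Tree.

Variables (V : finType) (e : rel V) (r : V).
Hypothesis tree_e : is_tree e.

Let e_sym : symmetric e. Proof. by case: tree_e. Qed.
Let e_irr : irreflexive e. Proof. by case: tree_e. Qed.
Let e_conn : forall x y : V, connect e x y. Proof. by case: tree_e. Qed.

Local Notation dr := (dist e r).

(* Otherwise two paths descending to r from distinct such neighbours, both    *)
(* avoiding v, would close up to a cycle through v.                           *)
Lemma uniq_neighbour_le v u1 u2 :
  e v u1 -> e v u2 -> dr u1 <= dr v -> dr u2 <= dr v -> u1 = u2.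
Proof.
move=> e1 e2 d1 d2; apply/eqP/negPn/negP => n12.
pose e' := [rel x y | [&& e x y, x != v & y != v]].
have nv u : e v u -> u != v by move=> evu; apply: contraTneq evu => ->; rewrite e_irr.
have down k : forall u, dr u = k -> u != v -> dr u <= dr v -> connect e' u r.
  elim: k => [|k IH] u du nu leu.
    by move/eqP: du; rewrite dist_eq0 // => /eqP->; apply: connect0.
  have ur : u != r by apply: contra_eq_neq du => ->; rewrite dist_self.
  have [w ewu dw] := dist_pred e_conn ur.
  have lew : dr w < dr v by rewrite dw.
  have nw : w != v by apply: contraTneq lew => ->; rewrite ltnn.
  apply: (@connect_trans _ _ w); last by apply: IH => //; [move: dw; rewrite du => -[]|exact: ltnW].
  by apply: connect1; rewrite /= e_sym ewu nu nw.
have e'_sym : symmetric e' by move=> x y; rewrite /= e_sym [(x != v) && _]andbC.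
have : connect e' u1 u2.
  apply: (@connect_trans _ _ r); first exact: (down _ _ erefl (nv _ e1)).
  by rewrite (sym_connect_sym e'_sym) // (down _ _ erefl (nv _ e2)).
case/connectP => p ep lp; case/shortenP: ep lp => q eq Uq _ lp.
have sub : forall x, path e' x q -> path e x q && (v \notin q).
  elim: q {eq Uq lp} => [|y q IH] x //= /andP[/and3P[exy xv yv] /IH /andP[-> H2]].
  by rewrite exy inE negb_or eq_sym yv.
have /andP[eq' vq] := sub _ eq.
case: tree_e => _ _ _ /(_ (v :: u1 :: q)); rewrite /ucycle /= => H.
have {H} : (size q).+2 <= 2.
  apply: H; apply/andP; split; first rewrite e1 rcons_path eq' -lp e_sym e2 //.
  by move: Uq; rewrite /= => ->; rewrite inE negb_or vq eq_sym nv.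
by case: q lp {eq Uq sub eq' vq} => //= lp; rewrite lp eqxx in n12.
Qed.

(** If both ends were equally far from the root, [u] would be a second neighbour of [v] no farther
    than [v], beside the parent of [v]. *)
Lemma edge_dist u v : e u v -> dr v = (dr u).+1 \/ dr u = (dr v).+1.
Proof.
move=> euv; have evu : e v u by rewrite e_sym.
have l1 := dist_edge e_conn r euv; have l2 := dist_edge e_conn r evu.
have [duv|] := eqVneq (dr u) (dr v); last by lia.
have vr : v != r.
  apply: contraTneq euv => vr; move/eqP: duv; rewrite vr dist_self dist_eq0 //.
  by move=> /eqP<-; rewrite e_irr.
have [w ewv dw] := dist_pred e_conn vr.
have uw : u = w by apply: (uniq_neighbour_le evu); rewrite 1?e_sym //; lia.
by subst w; lia.
Qed.

Lemma card_parents v : #|[set u | e v u & dr u < dr v]| = (v != r).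
Proof.
have [->|vr] /= := eqVneq v r.
  by apply: eq_card0 => u; rewrite !inE dist_self ltn0 andbF.
have [p epv dp] := dist_pred e_conn vr.
rewrite (_ : [set _ | _ & _] = [set p]) ?cards1 //; apply/setP => u.
rewrite !inE; apply/andP/eqP => [[evu lu]|->]; last by rewrite e_sym epv -dp.
by apply: (uniq_neighbour_le evu); rewrite 1?e_sym //; lia.
Qed.

Lemma card_neighbours v :
  #|[set u | e v u]| = (v != r) + #|children e r v|.
Proof.
rewrite -card_parents -(cardsID [set u | dr u < dr v]); congr (_ + _).
  by apply: eq_card => u; rewrite !inE.
apply: eq_card => u; rewrite !inE /depth eqSS; case evu: (e v u); rewrite ?andbF //=.
by have := edge_dist evu; lia.
Qed.

(** Any orientation may be traded for the one from child to parent, where every node but the root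
    has out-degree one. *)
Lemma card_orient (o : rel V) :
    (forall x y, e x y -> o y x = ~~ o x y) ->
  \sum_u #|[set v | e u v & o u v]| = #|V|.-1.
Proof.
move=> oo.
have sumE (o' : rel V) :
    \sum_u #|[set v | e u v & o' u v]| = \sum_(p | e p.1 p.2 && o' p.1 p.2) 1.
  rewrite -(pair_big_dep xpredT (fun u v => e u v && o' u v) (fun _ _ => 1)) /=.
  by apply: eq_bigr => u _; rewrite sum1dep_card.
rewrite sumE (sum_orientation e_sym (w := fun _ _ => 1) (o1 := o) (o2 := fun x y => dr y < dr x)) //.
  rewrite -(sumE (fun x y => dr y < dr x)) -(cardC1 r) -sum1_card [RHS]big_mkcond.
  by apply: eq_bigr => u _; rewrite card_parents inE; case: eqP.
by move=> x y /edge_dist; lia.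
Qed.

End Tree.

(** * Sums over the labels *)

Section Labeling.

Variables (V : finType).

Lemma sum_labeling (phi : V -> nat) (f : nat -> nat) : is_labeling phi ->
  \sum_u f (phi u) = \sum_(1 <= i < #|V|.+1) f i.
Proof.
case=> phi_rg phi_inj phi_surj.
rewrite -[LHS](big_map phi xpredT f); apply: perm_big.
apply: uniq_perm; rewrite ?iota_uniq ?map_inj_uniq ?index_enum_uniq // => k.
rewrite mem_index_iota ltnS; apply/mapP/idP => [[v _ ->]|/phi_surj [v <-]] //.
by exists v; rewrite ?mem_index_enum.
Qed.

Lemma sum_subn_binomial K N : K <= N.+1 ->
  \sum_(1 <= i < N.+1) (K - i) = 'C(K, 2).
Proof.
elim: N K => [|N IH] K leK; first by rewrite big_geq //; case: K leK => [|[]].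
case: K leK => [|K leK]; first by rewrite big1.
rewrite big_ltn // big_add1 /= subn1 (eq_bigr (fun i => K - i)) => [|i _].
  by rewrite IH // binS bin1 addnC.
by rewrite subSS.
Qed.

Lemma label_along_labeling (s : seq V) (phi : V -> nat) :
  uniq s -> s =i V -> phi =1 label_along s -> is_labeling phi.
Proof.
move=> Us sV phiE.
have sz : size s = #|V| by rewrite -(card_uniqP Us); apply: eq_card.
have idx v : index v s < #|V| by rewrite -sz index_mem sV.
split=> [v | u v | k /andP[k_gt0 lek]]; first by rewrite phiE /= idx.
  by rewrite !phiE => -[/index_inj H]; apply: (H u); rewrite sV.
case: k k_gt0 lek => // k _ lek; have /card_gt0P [x0 _] : 0 < #|V| by lia.
by exists (nth x0 s k); rewrite phiE /label_along index_uniq // sz.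
Qed.

End Labeling.

(** * The lower bound and its equality case *)

Section Threshold.

Variables (V : finType) (e : rel V) (r : V) (D K : nat).
Hypothesis tree_e : is_tree e.
Hypothesis degD : forall u, #|[set v | e u v]| <= D.
Hypothesis leK : K <= #|V|.+1.

Definition fwd_degree (phi : V -> nat) u := #|[set v | e u v & phi u < phi v]|.

Lemma SL_fwd_degree phi : is_labeling phi ->
  SL e phi = \sum_u phi u * fwd_degree phi u.
Proof. by case: tree_e => ? ? ? _ [_ ? _]; apply: SL_sum. Qed.

Lemma sum_fwd_degree phi : is_labeling phi ->
  \sum_u fwd_degree phi u = #|V|.-1.
Proof.
case: tree_e => _ e_irr _ _ [_ phi_inj _].
apply: (card_orient r tree_e (o := fun u v => phi u < phi v)) => x y exy.
rewrite -leqNgt [RHS]leq_eqVlt (inj_eq phi_inj).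
by case: eqP => // yx; rewrite yx e_irr in exy.
Qed.

(** The bound holds node by node, and [leqif_sum] carries the equality case along. The node labelled
    exactly [K] gives equality whatever its out-degree. *)
Lemma SL_threshold phi : is_labeling phi ->
  K * #|V|.-1 <= SL e phi + D * 'C(K, 2)
    ?= iff [forall u, ((phi u < K) ==> (fwd_degree phi u == D))
                   && ((K < phi u) ==> (fwd_degree phi u == 0))].
Proof.
move=> lab; rewrite -(sum_fwd_degree lab) (SL_fwd_degree lab).
rewrite -(sum_subn_binomial leK) -(sum_labeling _ lab) !big_distrr -big_split /=.
apply: leqif_sum => u _.
have mD : fwd_degree phi u <= D.
  by apply: leq_trans (degD u); apply/subset_leq_card/subsetP => v; rewrite !inE => /andP[].
have [lt|gt|->] /= := ltngtP (phi u) K.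
- rewrite andbT -{1}(subnKC (ltnW lt)) mulnDl [D * _]mulnC.
  apply/leqifP; case: eqP => [->|ne]; first by rewrite eqxx.
  by rewrite ltn_add2l ltn_pmul2l; lia.
- rewrite (eqnP (ltnW gt)) muln0 addn0; apply/leqifP.
  by case: eqP => [->|ne]; rewrite ?muln0 ?eqxx // ltn_pmul2r; lia.
- by rewrite subnn muln0 addn0; apply/leqifP; rewrite eqxx.
Qed.

End Threshold.

(** * Optimality of the tree algorithm *)

Section Algorithm.

Variables (n d : nat) (V : finType) (e : rel V) (r : V).
Hypothesis tree_p : perfect_nary_tree n d e r.

Let tree_e : is_tree e. Proof. by case: tree_p. Qed.
Let e_conn : forall x y : V, connect e x y. Proof. by case: tree_e. Qed.

Local Notation dep := (depth e r).

Lemma depth_root : dep r = 1.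
Proof. by rewrite /depth dist_self. Qed.

Lemma edge_depth u v : e u v -> odd (dep v) = ~~ odd (dep u).
Proof. by move=> /(edge_dist r tree_e) [] eq; rewrite /depth eq /= ?negbK. Qed.

Lemma degree_le v : #|[set u | e v u]| <= n.+1.
Proof.
rewrite (card_neighbours r tree_e) -addn1 addnC leq_add ?leq_b1 //.
have [/eqP->|nl] := boolP (leaf e r v); first by rewrite cards0.
by case: tree_p => _ /(_ _ nl) ->.
Qed.

(** Leaves have depth [d], so a node of the other parity is internal. *)
Lemma degree_internal v : odd (dep v) != odd d -> #|[set u | e v u]| = n + (v != r).
Proof.
move=> dv; rewrite (card_neighbours r tree_e) addnC; congr (_ + _).
case: tree_p => _ chn lf; apply: chn.
by apply: contra dv => /lf ->.
Qed.

(** One form for both parities of [d]: the root has depth 1, so for even [d] it belongs to the first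
    class and merely comes last there. *)
Lemma tree_algorithm_split phi : tree_algorithm d e r phi ->
  exists t1 t2 : seq V,
    [/\ perm_eq t1 [seq v <- enum V | odd (dep v) != odd d],
        perm_eq t2 [seq v <- enum V | odd (dep v) == odd d],
        phi =1 label_along (t1 ++ t2)
      & ~~ odd d -> exists s1, t1 = rcons s1 r].
Proof.
case=> s1 [s2]; case: ifPn => [od|ed] [p1 p2 phiE].
  by exists s1, s2; split=> //; [move: p1|move: p2]; congr perm_eq; apply: eq_filter => v; case: odd.
exists (rcons s1 r), s2; split=> //; last 2 first.
- by rewrite cat_rcons.
- by exists s1.
- apply: (@perm_trans _ (r :: s1)); first by rewrite perm_rcons.
  apply: uniq_perm => [||v].
  + by rewrite /= (perm_mem p1) (perm_uniq p1) mem_filter eqxx andbF filter_uniq ?enum_uniq.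
  + by rewrite filter_uniq ?enum_uniq.
  + rewrite inE (perm_mem p1) mem_filter mem_enum mem_filter mem_enum !andbT.
    by have [->|_] := eqVneq v r; rewrite ?depth_root ?andbT //=; case: odd.
- by move: p2; congr perm_eq; apply: eq_filter => v; case: odd.
Qed.

(** Keeping [k] and avoiding subtraction lets optimality and the closed forms both be read off the
    same equation. *)
Lemma tree_algorithm_optimal phi : tree_algorithm d e r phi ->
  is_labeling phi /\
  exists k, [/\ #|V|.-1 = n.+1 * k + (~~ odd d) * n,
    k.+1 * #|V|.-1 = SL e phi + n.+1 * 'C(k.+1, 2)
    & forall psi, is_labeling psi ->
        k.+1 * #|V|.-1 <= SL e psi + n.+1 * 'C(k.+1, 2)].
Proof.
case/tree_algorithm_split => t1 [t2 [p1 p2 phiE last1]].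
have mem1 v : (v \in t1) = (odd (dep v) != odd d).
  by rewrite (perm_mem p1) mem_filter mem_enum andbT.
have mem2 v : (v \in t2) = (odd (dep v) == odd d).
  by rewrite (perm_mem p2) mem_filter mem_enum andbT.
have Us : uniq (t1 ++ t2).
  rewrite cat_uniq (perm_uniq p1) (perm_uniq p2) !(filter_uniq _ (enum_uniq V)) andbT /=.
  by apply/hasPn => v /=; rewrite mem1 mem2 negbK.
have sV : t1 ++ t2 =i V by move=> v; rewrite mem_cat mem1 mem2 orNb.
have lab : is_labeling phi by exact: label_along_labeling Us sV phiE.
have phi1 v : (v \in t1) = (phi v <= size t1).
  rewrite phiE /label_along index_cat; case: ifP => v1; first by rewrite index_mem.
  by rewrite -addnS -{2}[size t1]addn0 leq_add2l.
(* Adjacent depths have opposite parities: neighbours of a node of [t1] lie outside [t1] and have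
   larger labels, while those of any other node lie in [t1] and have smaller labels. *)
have fwd v : fwd_degree e phi v = if v \in t1 then n + (v != r) else 0.
  have [v1|v2] := ifPn.
    rewrite -degree_internal -?mem1 //; apply: eq_card => u; rewrite !inE.
    case evu: (e v u) => //=; move: (v1); rewrite phi1 => /leq_ltn_trans; apply.
    rewrite ltnNge -phi1 mem1 (edge_depth evu); move: v1; rewrite mem1.
    by case: odd; case: odd.
  apply: eq_card0 => u; rewrite !inE; apply/negP => /andP[evu lt].
  have : u \in t1 by rewrite mem1 (edge_depth evu); move: v2; rewrite mem1; case: odd; case: odd.
  by rewrite phi1 => le; move: v2; rewrite phi1 (leq_trans (ltnW lt)).
have Ut1 : uniq t1 by move: Us; rewrite cat_uniq => /andP[].
have sumt : #|V|.-1 = \sum_(v <- t1) (n + (v != r)).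
  rewrite (big_uniq _ Ut1) -(sum_fwd_degree r tree_e lab) [RHS]big_mkcond /=.
  by apply: eq_bigr => v _; rewrite fwd.
have sz1 : size t1 <= #|V| by rewrite -(card_uniqP Ut1) max_card.
have r1 : (r \in t1) = ~~ odd d by rewrite mem1 depth_root; case: (odd d).
split=> //.
suff [k [eqV lek lt_k gt_k]] : exists k,
    [/\ #|V|.-1 = n.+1 * k + (~~ odd d) * n, size t1 <= k.+1 <= #|V|.+1,
      forall v, phi v < k.+1 -> v \in t1 /\ v != r
    & forall v, k.+1 < phi v -> v \notin t1].
  exists k; case/andP: lek => _ lek.
  have thr := SL_threshold r tree_e degree_le lek.
  split=> // [|psi /thr []] //; apply/eqP; rewrite (thr _ lab).2.
  apply/forallP => v; rewrite fwd; apply/andP; split; apply/implyP.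
    by move=> /lt_k [-> ->]; rewrite addn1.
  by move=> /gt_k /negPf->.
have gt k : size t1 <= k.+1 -> forall v, k.+1 < phi v -> v \notin t1.
  by move=> le v lt; rewrite phi1 -ltnNge; apply: leq_ltn_trans lt.
have [od|ed] := boolP (odd d); rewrite ?mul0n ?mul1n.
  have nr v : v \in t1 -> v != r by apply: contraTneq => ->; rewrite r1 od.
  exists (size t1); split; [|by lia| |exact: gt].
    rewrite addn0 sumt (eq_big_seq (fun=> n.+1)) => [|v /nr ->]; last by rewrite addn1.
    by rewrite big_const_seq count_predT iter_addn_0.
  by move=> v; rewrite ltnS -phi1 => v1; split=> //; apply: nr.
have [s1 t1E] := last1 ed; have size_t1 : size t1 = (size s1).+1 by rewrite t1E size_rcons.
have rs1 : r \notin s1 by move: Ut1; rewrite t1E rcons_uniq => /andP[].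
(* The root receives label k+1, the threshold itself, so its degree [n] instead of [n.+1] costs
   nothing. *)
exists (size s1); split; [|by lia| |by apply: gt; rewrite size_t1].
  rewrite sumt t1E -cats1 big_cat big_seq1 eqxx addn0 /=; congr (_ + _).
  rewrite (eq_big_seq (fun=> n.+1)) => [|v v1]; last first.
    by rewrite (_ : v != r) ?addn1 //; apply: contraNneq rs1 => <-.
  by rewrite big_const_seq count_predT iter_addn_0.
move=> v lt; split; first by rewrite phi1 size_t1 ltnW.
apply: contraTneq lt => ->; rewrite -leqNgt phiE /label_along ltnS t1E cat_rcons.
by rewrite index_cat (negPf rs1) leq_addr.
Qed.

End Algorithm.

(** * The closed forms *)

Section Value.
Import GRing.Theory Num.Theory.
Local Open Scope ring_scope.

Lemma SL_formula (n k N SLv : nat) (odd_d : bool) :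
    (0 < N)%N -> N.-1 = (n.+1 * k + (~~ odd_d) * n)%N ->
    (k.+1 * N.-1 = SLv + n.+1 * 'C(k.+1, 2))%N ->
  let N' : rat := N%:R in let m : rat := n%:R in
  SLv%:R = if odd_d then (N' - 1) ^+ 2 / (2 * (m + 1)) + (N' - 1) / 2
    else (N' - 1 - m) ^+ 2 / (2 * (m + 1)) + m * (N' - 1 - m) / (m + 1)
         + (N' - 1 + m) / 2.
Proof.
case: N => // N _ /= NE SLE.
(* Doubling removes the binomial; [N] now denotes the number of edges. *)
have {SLE} SLE : (2 * k.+1 * N = 2 * SLv + n.+1 * (k.+1 * k))%N.
  have := mul_bin_diag k.+1 1; rewrite bin1 => bE.
  by rewrite -mulnA SLE mulnDr; congr addn; rewrite mulnCA bE.
have m1 : (n%:R + 1 : rat) != 0 by rewrite natr1 pnatr_eq0.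
have {}SLE := congr1 (fun x : nat => x%:R : rat) SLE.
have {}NE := congr1 (fun x : nat => x%:R : rat) NE.
move: SLE NE; rewrite !(natrD, natrM, =^~ natr1) => SLE NE.
have -> : (SLv%:R : rat) = (2 * (k%:R + 1) * N%:R - (n%:R + 1) * ((k%:R + 1) * k%:R)) / 2.
  by rewrite SLE; field.
by case: odd_d NE => /= ->; field.
Qed.

End Value.

Lemma tree_algorithm_exists (d : nat) (V : finType) (e : rel V) (r : V) :
  exists phi : V -> nat, tree_algorithm d e r phi.
Proof.
rewrite /tree_algorithm; case: (odd d); do 3!eexists; split=> //.
Qed.

Lemma optimal_tree_labelings (n d : nat) (V : finType) (e : rel V) (r : V) :
    perfect_nary_tree n d e r ->
  [/\ exists phi : V -> nat, tree_algorithm d e r phi,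
      forall phi : V -> nat, tree_algorithm d e r phi -> optimal_labeling e phi
    & forall phi : V -> nat, optimal_labeling e phi ->
        let N : rat := (#|V|%:R)%R in
        let m : rat := (n%:R)%R in
        ((SL e phi)%:R : rat)%R =
        (if odd d
         then (N - 1) ^+ 2 / (2 * (m + 1)) + (N - 1) / 2
         else (N - 1 - m) ^+ 2 / (2 * (m + 1)) + m * (N - 1 - m) / (m + 1)
              + (N - 1 + m) / 2)%R].
Proof.
move=> tree_p.
have [phi0 alg0] := tree_algorithm_exists d e r.
have opt phi : tree_algorithm d e r phi -> optimal_labeling e phi.
  move=> /(tree_algorithm_optimal tree_p) [lab [k [_ eq le]]]; split=> // psi /le.
  by rewrite eq leq_add2r.
split=> [||phi [lab min]]; [by exists phi0|by []|].
have [lab0 [k [NE eq _]]] := tree_algorithm_optimal tree_p alg0.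
have [_ min0] := opt _ alg0.
have SLE : SL e phi = SL e phi0 by apply/eqP; rewrite eqn_leq min ?min0.
by rewrite SLE; apply: SL_formula NE eq; apply/card_gt0P; exists r.
Qed.

(** * A program logic with time budgets *)

(* With p units of time available, c terminates from st, and Q holds of some  *)
(* lower bound on the time left and of the final state.                       *)
Definition wp (c : cmd) (st : state) (p : nat) (Q : nat -> state -> Prop) : Prop :=
  exists t st' p', [/\ exec c st t st', t + p' <= p & Q p' st'].

Lemma wp_weaken c st p q (Q Q' : nat -> state -> Prop) :
  wp c st p Q -> p <= q -> (forall p' st', Q p' st' -> Q' p' st') -> wp c st q Q'.
Proof.
move=> [t [st' [p' [E tp Qst']]]] le H; exists t, st', p'.
by split=> //; [apply: leq_trans tp le|apply: H].
Qed.

Lemma wp_skip st p (Q : nat -> state -> Prop) : 0 < p -> Q p.-1 st -> wp Skip st p Q.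
Proof. by case: p => // p _ q; exists 1, st, p; split=> //; constructor. Qed.

Lemma wp_assign st p y x (Q : nat -> state -> Prop) :
  ecost x < p -> Q (p - (ecost x).+1) (set_reg st y (eval st x)) ->
  wp (Assign y x) st p Q.
Proof.
by move=> lt q; do 3!eexists; split; [constructor| |exact: q]; rewrite subnKC // leqnn.
Qed.

Lemma wp_put st p a i x (Q : nat -> state -> Prop) :
  ecost i + ecost x < p ->
  Q (p - (ecost i + ecost x).+1) (set_arr st a (eval st i) (eval st x)) ->
  wp (Put a i x) st p Q.
Proof.
by move=> lt q; do 3!eexists; split; [constructor| |exact: q]; rewrite subnKC // leqnn.
Qed.

Lemma wp_seq c1 c2 st p (Q : nat -> state -> Prop) :
  wp c1 st p (fun p1 st1 => wp c2 st1 p1 Q) -> wp (Seq c1 c2) st p Q.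
Proof.
move=> [t1 [st1 [p1 [E1 le1 [t2 [st2 [p2 [E2 le2 q]]]]]]]].
by exists (t1 + t2), st2, p2; split=> //; [apply: ExecSeq E1 E2|lia].
Qed.

Lemma wp_if x y c1 c2 st p (Q : nat -> state -> Prop) :
  ecost x + ecost y < p ->
  wp (if eval st x < eval st y then c1 else c2) st (p - (ecost x + ecost y).+1) Q ->
  wp (IfLt x y c1 c2) st p Q.
Proof.
move=> lt [t [st' [p' [E tp q]]]]; exists (ecost x + ecost y + t).+1, st', p'.
split=> //; last by lia.
by case: ltnP E => ?; [apply: ExecIfTrue|apply: ExecIfFalse].
Qed.

(** The budget serves as termination measure: each test consumes time, and the invariant guarantees
    that the next test can be paid for. *)
Lemma wp_while (I : nat -> state -> Prop) x y c (Q : nat -> state -> Prop) :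
    (forall p st, I p st -> ecost x + ecost y < p) ->
    (forall p st, I p st -> eval st x < eval st y ->
       wp c st (p - (ecost x + ecost y).+1) I) ->
    (forall p st, I p st -> eval st y <= eval st x ->
       Q (p - (ecost x + ecost y).+1) st) ->
  forall p st, I p st -> wp (WhileLt x y c) st p Q.
Proof.
move=> cost body exit p; have [k] := ubnP p; elim: k p => // k IH p lepk st Ist.
have lt := cost _ _ Ist; case: (ltnP (eval st x) (eval st y)) => xy.
  have [t1 [st1 [p1 [E1 tp1 I1]]]] := body _ _ Ist xy.
  have [|t2 [st2 [p2 [E2 tp2 q]]]] := IH p1 _ st1 I1; first by lia.
  exists (ecost x + ecost y + t1 + t2).+1, st2, p2; split=> //; last by lia.
  exact: ExecWhileTrue xy E1 E2.
exists (ecost x + ecost y).+1, st, (p - (ecost x + ecost y).+1).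
by split; [apply: ExecWhileFalse|lia|apply: exit].
Qed.

Definition IfEq (x y : expr) (c : cmd) : cmd := IfLt x y Skip (IfLt y x Skip c).

Definition IfNeq (x y : expr) (c : cmd) : cmd := IfLt x y c (IfLt y x c Skip).

Lemma wp_ifeq x y c st p (Q : nat -> state -> Prop) :
  let T := 2 * (ecost x + ecost y).+1 in
  T < p ->
  (eval st x = eval st y -> wp c st (p - T) Q) ->
  (eval st x <> eval st y -> Q (p - T.+1) st) ->
  wp (IfEq x y c) st p Q.
Proof.
move=> T lt eq neq; apply: wp_if; first by lia.
case: ltnP => xy.
  (* This branch makes a single test; the surplus is dropped so that both unequal cases leave the
     same budget. *)
  apply: (@wp_weaken _ _ (p - T) _ Q); [|by lia|by []].
  by apply: wp_skip; [lia|rewrite -subnS; apply: neq; lia].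
apply: wp_if; first by lia.
rewrite -subnDA (_ : _ + _ = T); last by lia.
case: ltnP => yx; last by apply: eq; lia.
by apply: wp_skip; [lia|rewrite -subnS; apply: neq; lia].
Qed.

Lemma wp_ifneq x y c st p (Q : nat -> state -> Prop) :
  let T := 2 * (ecost x + ecost y).+1 in
  T < p ->
  (eval st x <> eval st y -> wp c st (p - T) Q) ->
  (eval st x = eval st y -> Q (p - T.+1) st) ->
  wp (IfNeq x y c) st p Q.
Proof.
move=> T lt neq eq; apply: wp_if; first by lia.
case: ltnP => xy.
  apply: (@wp_weaken _ _ (p - T) _ Q); [|by lia|by []].
  by apply: neq; lia.
apply: wp_if; first by lia.
rewrite -subnDA (_ : _ + _ = T); last by lia.
case: ltnP => yx; first by apply: neq; lia.
by apply: wp_skip; [lia|rewrite -subnS; apply: eq; lia].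
Qed.

(** * The program *)

(* Registers: 2 and 3 are the head and tail of the queue in array 3, 4 is the *)
(* current node, 5 a running index, 6 the next label and 8 a parity.  Arrays  *)
(* 4 and 5 hold the parent of a node, with the invalid number #|V| at the     *)
(* root, and the parity of its distance to the root.                          *)
Definition flip : cmd :=
  IfLt (Reg 8) (Const 1) (Assign 8 (Const 1)) (Assign 8 (Const 0)).

Definition push_neighbour : cmd :=
  Seq (Put 3 (Reg 3) (Get 1 (Reg 5)))
 (Seq (Put 4 (Get 1 (Reg 5)) (Reg 4))
 (Seq (Put 5 (Get 1 (Reg 5)) (Reg 8))
      (Assign 3 (Succ (Reg 3))))).

(** No visited marks, hence no array to clear: in a tree every neighbour except the parent is
    new. *)
Definition scan : cmd :=
  WhileLt (Reg 5) (Get 0 (Succ (Reg 4)))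
    (Seq (IfNeq (Get 1 (Reg 5)) (Get 4 (Reg 4)) push_neighbour)
         (Assign 5 (Succ (Reg 5)))).

Definition search : cmd :=
  Seq (Put 3 (Const 0) (Reg 1))
 (Seq (Put 4 (Reg 1) (Reg 0))
 (Seq (Put 5 (Reg 1) (Const 0))
 (Seq (Assign 2 (Const 0))
 (Seq (Assign 3 (Const 1))
      (WhileLt (Reg 2) (Reg 3)
        (Seq (Assign 4 (Get 3 (Reg 2)))
        (Seq (Assign 8 (Get 5 (Reg 4)))
        (Seq flip
        (Seq (Assign 5 (Get 0 (Reg 4)))
        (Seq (Assign 2 (Succ (Reg 2)))
             scan)))))))))).

(* The queue is read backwards so that the root comes last.                   *)
Definition label_parity : cmd :=
  Seq (Assign 5 (Reg 3))
      (WhileLt (Const 0) (Reg 5)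
        (Seq (Assign 5 (Pred (Reg 5)))
             (IfEq (Get 5 (Get 3 (Reg 5))) (Reg 8)
               (Seq (Put 2 (Get 3 (Reg 5)) (Reg 6))
                    (Assign 6 (Succ (Reg 6))))))).

(* The node at the end of the queue is a leaf, hence of depth d.              *)
Definition tree_labeling_program : cmd :=
  Seq search
 (Seq (Assign 8 (Get 5 (Get 3 (Pred (Reg 3)))))
 (Seq (Assign 6 (Const 1))
 (Seq flip
 (Seq label_parity
 (Seq flip
      label_parity))))).

Lemma wp_flip (b : bool) st p (Q : nat -> state -> Prop) :
  5 <= p -> reg st 8 = b -> Q (p - 5) (set_reg st 8 (~~ b)) -> wp flip st p Q.
Proof.
move=> lep st8 q; apply: wp_if => /=; first by lia.
by rewrite st8; case: b st8 q => st8 q; (apply: wp_assign; [|rewrite -subnDA]) => //=; lia.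
Qed.

(** * Correctness and cost of the search and of the labeling passes *)

Section Search.

Variables (V : finType) (e : rel V) (r : V).
Hypothesis tree_e : is_tree e.
Variables (nu : V -> nat) (off nbr : nat -> nat) (adj : V -> seq V).
Hypothesis nu_inj : injective nu.
Hypothesis nu_lt : forall v, nu v < #|V|.
Hypothesis adjE : forall v, perm_eq (adj v) (enum [set u | e v u]).
Hypothesis map_adj : forall v,
  map nu (adj v) = [seq nbr j | j <- index_iota (off (nu v)) (off (nu v).+1)].

Let e_sym : symmetric e. Proof. by case: tree_e. Qed.
Let e_conn : forall x y : V, connect e x y. Proof. by case: tree_e. Qed.

Local Notation dr := (dist e r).

Definition kids v := [seq u <- adj v | dr u == (dr v).+1].

Lemma mem_adj u v : (u \in adj v) = e v u.
Proof. by rewrite (perm_mem (adjE v)) mem_enum inE. Qed.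

Lemma adj_uniq v : uniq (adj v).
Proof. by rewrite (perm_uniq (adjE v)) enum_uniq. Qed.

Lemma mem_kids u v : (u \in kids v) = e v u && (dr u == (dr v).+1).
Proof. by rewrite mem_filter mem_adj andbC. Qed.

Lemma size_adj v : size (adj v) = off (nu v).+1 - off (nu v).
Proof. by rewrite -(size_map nu) map_adj size_map size_iota. Qed.

Lemma nth_adj v k : k < size (adj v) -> nbr (off (nu v) + k) = nu (nth r (adj v) k).
Proof.
move=> lt; rewrite -(nth_map r 0) // map_adj (nth_map 0) ?nth_iota //;
  by rewrite ?size_iota -size_adj.
Qed.

(** Amortization: besides its children a node scans at most its parent, so all scans together cost
    O(|V|). *)
Lemma size_adj_le v : size (adj v) <= (size (kids v)).+1.
Proof.
have -> : size (adj v) = #|[set u | e v u]|.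
  by rewrite -(card_uniqP (adj_uniq v)); apply: eq_card => u; rewrite inE mem_adj.
have -> : size (kids v) = #|children e r v|.
  rewrite -(card_uniqP (filter_uniq _ (adj_uniq v))); apply: eq_card => u.
  by rewrite mem_kids !inE /depth eqSS.
by rewrite (card_neighbours r tree_e) -add1n leq_add ?leq_b1.
Qed.

Lemma leaf_kids v : kids v = [::] -> leaf e r v.
Proof.
move=> k0; apply/eqP/setP => u; rewrite !inE /depth eqSS.
by have := mem_kids u v; rewrite k0 in_nil => <-.
Qed.

(** Distinct nodes have disjoint [kids] because parents are unique. *)
Lemma kids_flatten_uniq s : uniq s -> uniq (r :: flatten (map kids s)).
Proof.
move=> Us; rewrite cons_uniq; apply/andP; split.
  by apply/flatten_mapP => -[v _]; rewrite mem_kids dist_self andbF.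
elim: s Us => //= v s IH /andP[vs /IH Us].
rewrite cat_uniq filter_uniq ?adj_uniq //= Us andbT.
apply/hasPn => u /flatten_mapP[w ws uw]; apply: contra vs => uv.
move: uw uv; rewrite !mem_kids => /andP[ewu /eqP dw] /andP[evu /eqP dv].
by rewrite (@uniq_neighbour_le _ _ r tree_e u v w) // 1?e_sym //; lia.
Qed.

Lemma kids_closed_full (s : seq V) : s = r :: flatten (map kids s) -> s =i V.
Proof.
move=> sE v; rewrite [RHS]inE; have [k] := ubnP (dr v).
elim: k v => // k IH v lev; rewrite sE inE.
have [//|vr] := eqVneq v r; have [u euv du] := dist_pred e_conn vr.
by apply/flatten_mapP; exists u; [apply: IH; lia|rewrite mem_kids euv du eqxx].
Qed.

(** Array 4 is specified through the test that reads it, so the root, whose entry matches no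
    neighbour, is no special case. *)
Definition queue_state (q : seq V) (st : state) : Prop :=
  [/\ arr st 0 = off /\ arr st 1 = nbr, reg st 3 = size q,
      forall i, i < size q -> arr st 3 i = nu (nth r q i),
      forall u v, v \in q -> e v u -> (nu u == arr st 4 (nu v)) = (dr u < dr v)
    & forall v, v \in q -> arr st 5 (nu v) = odd (dr v)].

Lemma wp_push v u q st p (Q : nat -> state -> Prop) :
    queue_state q st -> e v u -> dr u = (dr v).+1 ->
    nbr (reg st 5) = nu u -> reg st 4 = nu v -> reg st 8 = ~~ odd (dr v) ->
    15 <= p ->
    (forall st', queue_state (rcons q u) st' ->
       (forall i, i != 3 -> reg st' i = reg st i) -> Q (p - 15) st') ->
  wp push_neighbour st p Q.
Proof.
move=> [[st0 st1] st3 q3 q4 q5] evu du nu5 nu4 nu8 lep H.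
apply/wp_seq/wp_put => /=; first by lia.
apply/wp_seq/wp_put => /=; first by lia.
apply/wp_seq/wp_put => /=; first by lia.
apply/wp_assign => /=; first by lia.
rewrite -!subnDA; apply: H; last by move=> i /negPf /= ->.
rewrite st1 st3 nu4 nu5 nu8; split=> //=; first by rewrite size_rcons.
- move=> i; rewrite size_rcons nth_rcons ltnS leq_eqVlt.
  by case: eqP => [->|_] /= lt; rewrite ?ltnn // lt q3.
- move=> w x; rewrite mem_rcons inE (inj_eq nu_inj).
  have [->|_] /= := eqVneq x u; last exact: q4.
  move=> _ euw; rewrite (inj_eq nu_inj); apply/eqP/idP => [->|lt]; first by rewrite du.
  by apply: (uniq_neighbour_le tree_e (r := r) euw); rewrite 1?e_sym //; lia.
- move=> x; rewrite mem_rcons inE (inj_eq nu_inj).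
  by have [->|_] /= := eqVneq x u; [rewrite du|exact: q5].
Qed.

Lemma wp_scan v q st p (Q : nat -> state -> Prop) :
    queue_state q st -> v \in q ->
    reg st 4 = nu v -> reg st 5 = off (nu v) -> reg st 8 = ~~ odd (dr v) ->
    40 * size (adj v) + 10 <= p ->
    (forall p' st', p <= 40 * size (adj v) + 10 + p' ->
       queue_state (q ++ kids v) st' -> reg st' 2 = reg st 2 -> Q p' st') ->
  wp scan st p Q.
Proof.
move=> qst vq st4 st5 st8 lep H.
(* The first bound limits the time spent so far, the second reserves time for the remaining entries;
   a round costs at most 33. *)
pose I p' st' := exists k, [/\ k <= size (adj v),
  p <= 40 * k + p' /\ 40 * (size (adj v) - k) + 10 <= p',
  queue_state (q ++ [seq u <- take k (adj v) | dr u == (dr v).+1]) st',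
  reg st' 5 = off (nu v) + k
  & [/\ reg st' 4 = nu v, reg st' 8 = ~~ odd (dr v) & reg st' 2 = reg st 2]].
apply: (@wp_while I) => [p1 st1|p1 st1|p1 st1|].
- by case=> k [_ [_ le] _ _ _] /=; lia.
- case=> k [lek [le1 le2] qst1 e5 [e4 e8 e2]] /=.
  case: (qst1) => -[a0 a1] _ _ q4 _.
  rewrite a0 e4 e5 => lt.
  have {}lek : k < size (adj v) by rewrite size_adj; lia.
  set u := nth r (adj v) k; have nbrE := nth_adj lek.
  have evu : e v u by rewrite -mem_adj mem_nth.
  have vq' : v \in q ++ [seq u <- take k (adj v) | dr u == (dr v).+1].
    by rewrite mem_cat vq.
  have code := q4 u v vq' evu; have du := edge_dist r tree_e evu.
  have step st' : queue_state (q ++ [seq u <- take k.+1 (adj v) | dr u == (dr v).+1]) st' ->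
      (forall i, i != 3 -> reg st' i = reg st1 i) -> forall p', 
      p1 <= p' + 37 -> I (p' - 3) (set_reg st' 5 (reg st' 5).+1).
    move=> [? ? ? ? ?] fr p' lep'; exists k.+1; split=> //=; first by lia.
    - by rewrite fr // e5 addnS.
    - by rewrite !fr.
  rewrite (take_nth r lek) filter_rcons -/u in step.
  apply/wp_seq/wp_ifneq => /=; first by lia.
    rewrite a1 e4 e5 nbrE => /eqP; rewrite code => ndu.
    have {}du : dr u = (dr v).+1 by lia.
    apply: (wp_push qst1 evu du) => //; [by rewrite e5|by lia|].
    move=> st2 qst2 fr; apply: wp_assign => /=; first by lia.
    apply: step => //; last by lia.
    by rewrite du eqxx -rcons_cat.
  rewrite a1 e4 e5 nbrE => /eqP; rewrite code => ndu.
  apply: wp_assign => /=; first by lia.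
  apply: step => //; last by lia.
  by case: eqP => //; lia.
- case=> k [lek [le1 le2] qst1 e5 [e4 e8 e2]] /=; case: (qst1) => -[a0 a1] _ _ _ _.
  rewrite a0 e4 e5 => ge.
  have kE : k = size (adj v) by apply/eqP; rewrite eqn_leq lek size_adj; lia.
  by apply: H; [lia|move: qst1; rewrite kE take_size|].
- by exists 0; rewrite take0 cats0 addn0; split=> //; lia.
Qed.

Lemma wp_search st p (Q : nat -> state -> Prop) :
    arr st 0 = off -> arr st 1 = nbr -> reg st 0 = #|V| -> reg st 1 = nu r ->
    130 * #|V| + 30 <= p ->
    (forall p' st' q, p <= 130 * #|V| + 30 + p' -> queue_state (r :: q) st' ->
       perm_eq (r :: q) (enum V) -> leaf e r (last r q) -> Q p' st') ->
  wp search st p Q.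
Proof.
move=> st0 st1 reg0 reg1 lep H.
do 2!(apply/wp_seq/wp_put => /=; first by lia).
apply/wp_seq/wp_put => /=; first by lia.
do 2!(apply/wp_seq/wp_assign => /=; first by lia).
rewrite -!subnDA /= reg0 reg1.
(* Each node taken off the queue is charged 90, for the fixed part of its round and its parent
   entry; each queued node is charged 40, for being scanned by its parent. The last clause will show
   that the queue ends in a leaf. *)
pose I p' st' := exists q h, [/\ q = r :: flatten (map kids (take h q)),
  uniq q,
  p <= 90 * h + 40 * size q + 10 + p' /\
    90 * (#|V| - h) + 40 * (#|V| - size q) + 10 <= p',
  queue_state q st'
  & [/\ reg st' 2 = h, h <= size q & 0 < h -> h = size q -> kids (nth r q h.-1) = [::]]].
have size_le (q : seq V) : uniq q -> size q <= #|V|.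
  by move=> Uq; rewrite -(card_uniqP Uq) max_card.
have V_gt0 : 0 < #|V| by apply/card_gt0P; exists r.
apply: (@wp_while I) => [p1 st2|p1 st2|p1 st2|].
- by case=> q [h [_ _ [_ le] _ _]] /=; lia.
- case=> q [h [qE Uq [le1 le2] qst [e2 leh hk]]] /=.
  case: (qst) => -[a0 a1] e3 q3 q4 q5; rewrite e2 e3 => lth.
  set v := nth r q h; have vq : v \in q by rewrite mem_nth.
  have tk (s : seq V) : take h.+1 (q ++ s) = rcons (take h q) v.
    by rewrite takel_cat // (take_nth r).
  have qE' : q ++ kids v = r :: flatten (map kids (take h.+1 (q ++ kids v))).
    by rewrite tk map_rcons flatten_rcons -cat_cons -qE.
  have Uq' : uniq (q ++ kids v).
    by rewrite qE' kids_flatten_uniq // tk -(take_nth r) // take_uniq.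
  have := size_le _ Uq'; rewrite size_cat => leV.
  have leh' : h < #|V| by lia.
  have szv := size_adj_le v.
  apply/wp_seq/wp_assign => /=; first by lia.
  rewrite e2 q3 // -/v.
  apply/wp_seq/wp_assign => /=; first by lia.
  rewrite q5 //.
  apply/wp_seq/(wp_flip (b := odd (dr v))) => //=; first by lia.
  apply/wp_seq/wp_assign => /=; first by lia.
  apply/wp_seq/wp_assign => /=; first by lia.
  rewrite -!subnDA /= a0 e2.
  apply: (@wp_scan v q) => //=; first by lia.
  move=> p' st' lep' qst' e2'; exists (q ++ kids v), h.+1; split=> //.
    by rewrite size_cat; lia.
  split; rewrite ?size_cat ?e2' //=; first by lia.
  (* If the head has caught up with the tail, the node just expanded has added nothing. *)
  by move=> _ hE; rewrite nth_cat lth -/v; apply: size0nil; lia.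
- case=> q [h [qE Uq [le1 le2] qst [e2 leh hk]]] /=.
  case: (qst) => _ e3 _ _ _; rewrite e2 e3 => geh.
  have hE : h = size q by apply/eqP; rewrite eqn_leq leh.
  have qV : q =i V by apply: kids_closed_full; rewrite {1}qE hE take_size.
  have := size_le _ Uq => leV.
  case: q qE Uq le1 le2 qst leh hk e3 geh hE qV leV => // x q [-> _] Uq.
  move=> le1 le2 qst leh hk e3 geh hE qV leV.
  apply: (H _ _ q) => //; first by lia.
    by apply: uniq_perm; rewrite ?enum_uniq // => v; rewrite qV mem_enum.
  by apply: leaf_kids; rewrite (last_nth r) -hk ?hE.
exists [:: r], 0; split=> //=; first by set N := #|V| in lep *; lia.
split=> //= [[|i] //|u v|v]; rewrite inE => /eqP-> //.
- move=> eru; rewrite eqxx dist_self ltn0; apply/eqP => nuE.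
  by have := nu_lt u; rewrite nuE ltnn.
- by rewrite eqxx dist_self.
Qed.

(** Here [c] labels are already in use; leaving the labels of the other class untouched lets two
    passes be composed. *)
Lemma wp_label_parity q (b : bool) c st p (Q : nat -> state -> Prop) :
    queue_state q st -> uniq q -> reg st 8 = b -> reg st 6 = c.+1 ->
    30 * size q + 10 <= p ->
    (let t := [seq v <- rev q | odd (dr v) == b] in
     forall p' st', p <= 30 * size q + 10 + p' ->
       queue_state q st' -> reg st' 8 = b -> reg st' 6 = (c + size t).+1 ->
       (forall v, v \in q -> arr st' 2 (nu v) =
          if v \in t then (c + index v t).+1 else arr st 2 (nu v)) ->
       Q p' st') ->
  wp label_parity st p Q.
Proof.
move=> qst Uq e8 e6 lep H; case: (qst) => _ e3 _ _ _.
apply/wp_seq/wp_assign => /=; first by lia.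
pose I p' st' := exists i, let t := [seq v <- rev (drop i q) | odd (dr v) == b] in
  [/\ i <= size q,
  p <= 30 * (size q - i) + 3 + p' /\ 30 * i + 5 <= p',
  queue_state q st',
  [/\ reg st' 5 = i, reg st' 8 = b & reg st' 6 = (c + size t).+1]
  & forall v, v \in q -> arr st' 2 (nu v) =
      if v \in t then (c + index v t).+1 else arr st 2 (nu v)].
apply: (@wp_while I) => [p1 st1|p1 st1|p1 st1|].
- by case=> i [_ [_ le] _ _ _] /=; lia.
- case=> i [lei [le1 le2] qst1 [f5 f8 f6] a2] /=; rewrite f5 => i_gt0.
  case: i i_gt0 lei le1 le2 f5 f6 a2 => // i _ lei le1 le2 f5 f6 a2.
  case: (qst1) => -[a0 a1] f3 q3 q4 q5.
  set v := nth r q i; have vq : v \in q by rewrite mem_nth.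
  have dropE : [seq v <- rev (drop i q) | odd (dr v) == b] =
      let t := [seq v <- rev (drop i.+1 q) | odd (dr v) == b] in
      if odd (dr v) == b then rcons t v else t.
    by rewrite (drop_nth r) // rev_cons filter_rcons.
  have vt : v \notin [seq v <- rev (drop i.+1 q) | odd (dr v) == b].
    have : uniq (drop i q) by exact: drop_uniq.
    rewrite (drop_nth r) // cons_uniq => /andP[vd _].
    by rewrite mem_filter mem_rev (negPf vd) andbF.
  set t := [seq v <- _ | _] in f6 a2 dropE vt.
  apply/wp_seq/wp_assign => /=; first by lia.
  rewrite f5 /=; apply: wp_ifeq => /=; first by lia.
    rewrite q3 // q5 // -/v f8 => dv.
    have {}dv : odd (dr v) = b by move: dv; case: (odd _); case: (b).
    apply/wp_seq/wp_put => /=; first by lia.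
    apply: wp_assign => /=; first by lia.
    rewrite -!subnDA; exists i; rewrite dropE dv eqxx /=.
    split=> //=; [by lia|by lia| |].
      by rewrite f8 f6 size_rcons addnS.
    move=> w wq; rewrite q3 // -/v (inj_eq nu_inj) mem_rcons inE f6.
    have [->|nwv] /= := eqVneq w v.
      by rewrite -cats1 index_cat (negPf vt) /= eqxx addn0.
    by rewrite a2 //; case: ifP => // wt; rewrite -cats1 index_cat wt.
  rewrite q3 // q5 // -/v f8 => dv; rewrite -!subnDA.
  exists i; rewrite dropE (_ : odd (dr v) == b = false) /=; last by apply/eqP => dvb; rewrite dvb in dv.
  by split=> //=; lia.
- case=> i [lei [le1 le2] qst1 [f5 f8 f6] a2] /=; rewrite f5 leqn0 => /eqP i0.
  move: a2 f6; rewrite i0 drop0 => a2 f6.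
  by apply: H => //; lia.
- exists (size q); rewrite drop_size /= addn0 e3 e6 e8; split=> //; lia.
Qed.

End Search.

(** * From the numbered input to the complete run *)

Lemma represents_adjacency (V : finType) (e : rel V) (r : V) (nu : V -> nat) st :
    represents e r nu st ->
  exists adj : V -> seq V,
    (forall v, perm_eq (adj v) (enum [set u | e v u])) /\
    (forall v, map nu (adj v) = [seq arr st 1 j
       | j <- index_iota (arr st 0 (nu v)) (arr st 0 (nu v).+1)]).
Proof.
case=> nu_inj _ _ _ adjP.
(* The default [r] is harmless, since every adjacency entry is the number of a node. *)
pose node x := odflt r [pick v | nu v == x].
have nodeK : cancel nu node.
  move=> v; rewrite /node; case: pickP => [u /eqP/nu_inj|/(_ v)] //.
  by rewrite eqxx.
pose nbrs v := [seq arr st 1 j | j <- index_iota (arr st 0 (nu v)) (arr st 0 (nu v).+1)].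
exists (fun v => map node (nbrs v)); split=> v.
  have := perm_map node (adjP v); rewrite (mapK nodeK).
  move/perm_trans; apply; apply: uniq_perm => [||u]; rewrite ?enum_uniq //.
    by rewrite filter_uniq // enum_uniq.
  by rewrite mem_filter !mem_enum !inE andbT.
rewrite -map_comp -[RHS]map_id; apply/eq_in_map => x.
by rewrite (perm_mem (adjP v)) => /mapP[u _ ->] /=; rewrite nodeK.
Qed.

(** Depth is distance plus one, so distance parity [odd d] selects the depths of parity opposite to
    [d]. Reversing the queue puts the root last in its class, as even [d] requires. *)
Lemma parity_order_tree_algorithm (n d : nat) (V : finType) (e : rel V) (r : V)
    (q : seq V) (phi : V -> nat) :
    perfect_nary_tree n d e r -> perm_eq (r :: q) (enum V) ->
    let s b := [seq v <- rev (r :: q) | odd (dist e r v) == b] in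
    phi =1 label_along (s (odd d) ++ s (~~ odd d)) ->
  tree_algorithm d e r phi.
Proof.
move=> tree_p qV s phiE.
have e_conn : forall x y, connect e x y by case: tree_p => -[].
have Uq : uniq (r :: q) by rewrite (perm_uniq qV) enum_uniq.
have sP b (a : pred V) : (forall v, a v = (odd (dist e r v) == b)) ->
    perm_eq (s b) [seq v <- enum V | a v].
  move=> aE; by rewrite (eq_filter aE) perm_filter // perm_rev.
have [od|ed] := boolP (odd d).
  exists (s true), (s false); rewrite od; split; [| |by move: phiE; rewrite od].
    by apply: sP => v; rewrite /depth /= negbK eqb_id.
  by apply: sP => v; rewrite /depth /= eqbF_neg.
pose s1 := [seq v <- rev q | odd (dist e r v) == false].
have sE : s false = rcons s1 r.
  by rewrite /s rev_cons filter_rcons dist_self // eqxx.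
exists s1, (s true); rewrite (negPf ed); split.
- apply: uniq_perm => [||v].
  + by rewrite filter_uniq // rev_uniq; case/andP: Uq.
  + by rewrite filter_uniq // enum_uniq.
  have vrq : v \in r :: q by rewrite (perm_mem qV) mem_enum.
  rewrite mem_filter mem_rev mem_filter mem_enum andbT eqbF_neg; congr (_ && _).
  move: Uq vrq; rewrite /= inE => /andP[rq _].
  by have [->|_ /= ->] := eqVneq v r; first by rewrite (negPf rq).
- by apply: sP => v; rewrite /depth /= negbK eqb_id.
- by move: phiE; rewrite (negPf ed) sE cat_rcons.
Qed.

Lemma tree_labeling_program_linear : linear_time_tree_algorithm tree_labeling_program.
Proof.
(* The search takes at most 130|V|+30, each pass 30|V|+10, and the rest is constant; |V| is
   positive. *)
exists 300 => n d V e r n_gt0 tree_p nu st rep.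
have [adj [adjE map_adj]] := represents_adjacency rep.
have [nu_inj nu_lt [reg0 reg1] _ _] := rep.
have tree_e : is_tree e by case: tree_p.
have V_gt0 : 0 < #|V| by apply/card_gt0P; exists r.
suff : wp tree_labeling_program st (300 * #|V|)
    (fun _ st' => tree_algorithm d e r (output_labeling nu st')).
  by move=> [t [st' [p' [E le alg]]]]; exists t, st'; split=> //; lia.
set N := #|V| in V_gt0 nu_lt *.
apply/wp_seq/(wp_search (r := r) tree_e nu_inj nu_lt adjE map_adj) => //; rewrite -/N; first by lia.
move=> p1 st1 q le1 qst1 qV leafq.
have size_q : size (r :: q) = N by rewrite (perm_size qV) -cardE.
have Uq : uniq (r :: q) by rewrite (perm_uniq qV) enum_uniq.
case: (qst1) => _ e3 q3 _ q5.
apply/wp_seq/wp_assign => /=; first by lia.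
rewrite e3 /= q3 // nth_last q5 /= ?mem_last //.
set st2 := set_reg _ _ _.
have qst2 : queue_state e r nu _ _ (r :: q) st2 := qst1.
(* The bit stored at a leaf is the negation of [odd d]; the first [flip] turns it into the class to
   be labelled first. *)
have par_d : odd (dist e r (last r q)) = ~~ odd d.
  by case: tree_p => _ _ /(_ _ leafq) <-; rewrite negbK.
apply/wp_seq/wp_assign => /=; first by lia.
apply/wp_seq/(wp_flip (b := ~~ odd d)) => /=; [by lia|by rewrite par_d|].
rewrite negbK; set st3 := set_reg _ _ _.
have qst3 : queue_state e r nu _ _ (r :: q) st3 := qst1.
apply/wp_seq/(wp_label_parity (c := 0) nu_inj qst3 Uq (b := odd d)) => //.
  by rewrite size_q; lia.
move=> t1 p4 st4; rewrite size_q => le4 qst4 e48 e46 lab4.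
apply/wp_seq/(wp_flip (b := odd d)) => //; first by lia.
set st5 := set_reg _ _ _.
have qst5 : queue_state e r nu _ _ (r :: q) st5 := qst4.
apply: (wp_label_parity (c := size t1) nu_inj qst5 Uq (b := ~~ odd d)) => //; first by rewrite size_q; lia.
move=> t2 p6 st6 _ _ _ _ lab6.
apply: (parity_order_tree_algorithm tree_p qV) => v.
have vq : v \in r :: q by rewrite (perm_mem qV) mem_enum.
rewrite /output_labeling lab6 // lab4 // /label_along index_cat.
rewrite -/t1 -/t2.
have -> : (v \in t2) = (v \notin t1).
  rewrite !mem_filter mem_rev vq !andbT.
  by case: (odd (dist e r v)); case: (odd d).
by case: (v \in t1).
Qed.

Theorem mainTheorem7 :
  (exists p : cmd, linear_time_tree_algorithm p) /\
  forall (n d : nat) (V : finType) (e : rel V) (r : V),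
    1 <= n -> perfect_nary_tree n d e r ->
  [/\ exists phi : V -> nat, tree_algorithm d e r phi,
      forall phi : V -> nat, tree_algorithm d e r phi -> optimal_labeling e phi
    & forall phi : V -> nat, optimal_labeling e phi ->
        let N : rat := (#|V|%:R)%R in
        let m : rat := (n%:R)%R in
        ((SL e phi)%:R : rat)%R =
        (if odd d
         then (N - 1) ^+ 2 / (2 * (m + 1)) + (N - 1) / 2
         else (N - 1 - m) ^+ 2 / (2 * (m + 1)) + m * (N - 1 - m) / (m + 1)
              + (N - 1 + m) / 2)%R].
Proof.
split; first by exists tree_labeling_program; apply: tree_labeling_program_linear.
by move=> n d V e r _ tree_p; apply: optimal_tree_labelings.
Qed.
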